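(* Let $S \subseteq \mathbb{N}$ be an additive subsemigroup (containing $0$) with $S \neq \{0\}$. Then $\dim_{\mathrm{mat}} S \leq \min(S \setminus \{0\})$.
   Context: $\mathbb{N} = \{0,1,2,\ldots\}$. $\mathrm{M}_d(\mathbb{Z})$ and $\mathrm{M}_d(\mathbb{Q})$ denote the sets of $d \times d$ matrices with entries in $\mathbb{Z}$ and $\mathbb{Q}$, respectively. For $A \in \mathrm{M}_d(\mathbb{Q})$, the exponent semigroup of $A$ is $\mathcal{S}(A) = \{ n \in \mathbb{N} : A^n \in \mathrm{M}_d(\mathbb{Z})\}$ (with $A^0 = I$). The matricial dimension of an additive subsemigroup $S$ of $\mathbb{N}$ containing $0$ is $\dim_{\mathrm{mat}} S = \min\{ d \geq 1 : \text{there is an } A \in \mathrm{M}_d(\mathbb{Q}) \text{ such that } S = \mathcal{S}(A)\}$; it is known that every such $S$ is an exponent semigroup of some rational matrix, so this minimum exists. *)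

(* Defs.v *)
From mathcomp Require Import all_boot all_order all_algebra.
From mathcomp Require Import boolp classical_sets.

Set Implicit Arguments.
Unset Strict Implicit.
Unset Printing Implicit Defensive.

Import GRing.Theory Num.Theory.

Local Open Scope ring_scope.
Local Open Scope classical_set_scope.

Definition additive_subsemigroup (S : set nat) : Prop :=
  S 0%N /\ (forall m n : nat, S m -> S n -> S (m + n)%N).

Definition exponent_semigroup (d : nat) (A : 'M[rat]_d) : set nat :=
  [set n : nat | A ^+ n \is a mxOver Num.int].

Definition is_minimum (X : set nat) (m : nat) : Prop :=
  X m /\ (forall n : nat, X n -> (m <= n)%N).

Definition realizing_dims (S : set nat) : set nat :=
  [set d : nat | (1 <= d)%N /\
                 exists A : 'M[rat]_d, S = exponent_semigroup A].

(* The matricial dimension is given by its graph, [dim_mat S = d], so that no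
   default value is needed for sets S that no rational matrix realizes. *)
Definition is_matricial_dimension (S : set nat) (d : nat) : Prop :=
  is_minimum (realizing_dims S) d.

(* Main.v *)
(** Let [A] be the weighted cyclic permutation matrix of size [m] whose weights
    are chosen so that the only nonzero entry in row [i] of [A ^+ n] is
    [2 ^ q * c i / c j], where [i + n = q * m + j] with [j < m].
    For a residue [i] meeting [S], let [c i = 2 ^ k] with [k] least such that
    [i + k * m] is in [S] (the Apery element of the class of [i]); for the other
    residues let [c i = 3].  If [n] is in [S], then translation by [n] preserves
    [S] and the classes avoiding [S], so all the entries are integers.
    Conversely row [0], where [c 0 = 1], is integral only if [c j] divides
    [2 ^ q]; this excludes [c j = 3] and otherwise says that [n] is at least the
    Apery element of its class, i.e. that [n] is in [S]. *)
Require Import Defs.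
From mathcomp Require Import all_boot all_order all_algebra.
From mathcomp Require Import zify ring.
From mathcomp Require Import boolp classical_sets.

Local Open Scope classical_set_scope.

Import GRing.Theory Num.Theory.

(** Serves twice: for the least index in a residue class, and for the matricial dimension, where a
    single realization yields both existence and the bound. *)
Lemma min_nat_exists {X : set nat} {n : nat} :
  X n -> exists2 d, is_minimum X d & (d <= n)%N.
Proof.
move=> Xn.
have exX : exists k, `[< X k >] by exists n; apply/asboolP.
case: (ex_minnP exX) => d /asboolP Xd d_min.
exists d; last exact/d_min/asboolP.
by split=> // k Xk; apply/d_min/asboolP.
Qed.

Lemma int_num_natf_div (a b : nat) : (0 < b)%N ->
  ((a%:R / b%:R : rat)%R \is a Num.int) = (b %| a)%N.
Proof.
move=> b_gt0; have b_neq0 : (b%:R != 0 :> rat)%R by rewrite pnatr_eq0 -lt0n.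
apply/idP/idP => [/intrP[z /(canRL (divfK b_neq0)) Ez]|/dvdnP[k ->]].
  have /intr_inj Ez' : ((a%:Z)%:~R = (z * b%:Z)%:~R :> rat)%R.
    by rewrite intrM -!pmulrn.
  by have := congr1 absz Ez'; rewrite abszM !absz_nat => ->; rewrite dvdn_mull.
by rewrite natrM mulfK // natr_int.
Qed.

Section WeightedCycle.

Variables (m : nat) (c : nat -> nat).
Hypothesis c_gt0 : forall i, (0 < c i)%N.

(** With [D = diag(c)] this is [D * C * D^-1], where [C] is the cyclic shift with weight 2 on its
    wrap-around entry, so that [C ^+ m] is the scalar 2. *)
Definition weighted_cycle : 'M[rat]_m :=
  (\matrix_(i, j) (if j == (i.+1 %% m)%N :> nat
                   then (2 ^ (i.+1 %/ m) * c i)%N%:R / (c j)%:R else 0))%R.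

(** The ratios of weights telescope along the cycle, and the exponent of 2 counts the
    wrap-arounds. *)
Lemma weighted_cycle_exp n i j :
  (weighted_cycle ^+ n)%R i j =
  (if j == ((i + n) %% m)%N :> nat
   then (2 ^ ((i + n) %/ m) * c i)%N%:R / (c j)%:R else 0)%R.
Proof.
have c_neq0 k : ((c k)%:R != 0 :> rat)%R by rewrite pnatr_eq0 -lt0n.
elim: n i j => [|n IHn] i j.
  rewrite expr0 mxE addn0 modn_small // divn_small // mul1n eq_sym.
  by rewrite -val_eqE; case: eqP => // ->; rewrite divff.
have m_gt0 : (0 < m)%N by case: (m) i => [[]|].
pose k := Ordinal (ltn_pmod (i + n) m_gt0).
rewrite exprSr mxE (bigD1 k) //= big1 => [|l l_neq_k]; last first.
  by rewrite IHn -[_ == _ :> nat]/(l == k) (negPf l_neq_k) mul0r.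
rewrite addr0 IHn eqxx mxE /=.
have -> : ((i + n.+1) %% m = (((i + n) %% m).+1) %% m)%N.
  by rewrite -[in RHS]addn1 modnDml addn1 addnS.
(* The quotient gains a carry exactly when the residue is [m - 1], the row that carries the extra
   factor 2. *)
have -> : ((i + n.+1) %/ m = (i + n) %/ m + (((i + n) %% m).+1) %/ m)%N.
  by rewrite addnS {1}(divn_eq (i + n) m) -addnS divnMDl.
case: eqP => _; last by rewrite mulr0.
have ck_neq0 := c_neq0 ((i + n) %% m)%N; have cj_neq0 := c_neq0 j.
rewrite expnD !natrM; field.
by rewrite ck_neq0 cj_neq0.
Qed.

Lemma exponent_semigroup_weighted_cycle n : (0 < m)%N ->
  exponent_semigroup weighted_cycle n <->
  (forall i, (i < m)%N -> c ((i + n) %% m) %| 2 ^ ((i + n) %/ m) * c i).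
Proof.
move=> m_gt0; split=> [/mxOverP An i i_lt_m | cdvd].
  have := An (Ordinal i_lt_m) (Ordinal (ltn_pmod (i + n) m_gt0)).
  by rewrite weighted_cycle_exp eqxx int_num_natf_div.
apply/mxOverP => i j; rewrite weighted_cycle_exp.
case: eqP => [-> | _]; last exact: int_num0.
by rewrite int_num_natf_div //; apply: cdvd.
Qed.

End WeightedCycle.

Section AperyWeight.

Variables (S : set nat) (m : nat).
Hypotheses (hS : additive_subsemigroup S) (Sm : S m) (m_gt0 : (0 < m)%N).

Lemma subsemigroup_muln k n : S n -> S (k * n)%N.
Proof.
case: hS => S0 SD Sn; elim: k => // k IHk.
by rewrite mulSn; apply: SD.
Qed.

Definition apery_weight_spec (r w : nat) : Prop :=
  (exists2 k, is_minimum [set k | S (r + k * m)%N] k & w = (2 ^ k)%N) \/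
  ((forall k, ~ S (r + k * m)%N) /\ w = 3%N).

Lemma apery_weight_exists r : exists w, apery_weight_spec r w.
Proof.
have [[k Sk] | noS] := pselect (exists k, S (r + k * m)%N).
  have [d d_min _] := min_nat_exists (X := [set k | S (r + k * m)%N]) Sk.
  by exists (2 ^ d)%N; left; exists d.
by exists 3%N; right; split=> // k Sk; apply: noS; exists k.
Qed.

Definition apery_weight r : nat := projT1 (cid (apery_weight_exists r)).

Lemma apery_weightP r : apery_weight_spec r (apery_weight r).
Proof. by rewrite /apery_weight; case: cid. Qed.

Lemma apery_weight_gt0 r : (0 < apery_weight r)%N.
Proof. by case: (apery_weightP r) => [[k _ ->]|[_ ->]] //; rewrite expn_gt0. Qed.

Lemma apery_weight0 : apery_weight 0 = 1%N.
Proof.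
have [S0 _] := hS.
case: (apery_weightP 0) => [[k [_ k_min] ->] | [/(_ 0%N)]] //.
by have := k_min 0%N S0; rewrite leqn0 => /eqP ->.
Qed.

Lemma apery_weight_dvd n i : S n ->
  apery_weight ((i + n) %% m) %| 2 ^ ((i + n) %/ m) * apery_weight i.
Proof.
have [_ SD] := hS; move=> Sn; have Ein := divn_eq (i + n) m.
have shiftE k : ((i + n) %% m + ((i + n) %/ m + k) * m = (i + k * m) + n)%N.
  by rewrite mulnDl; lia.
case: (apery_weightP i) => [[k [Sk _] ->] | [noSi ->]];
  case: (apery_weightP ((i + n) %% m)) => [[l [Sl l_min] ->] | [noSj ->]].
(* Adding [n] to [i + k * m] gives an element of [S] in the class of [i + n], with index
   [(i + n) %/ m + k]; minimality of [l] bounds [l] by it. *)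
- rewrite -expnD dvdn_Pexp2l //; apply: l_min => /=.
  by rewrite shiftE; apply: SD.
- case: (noSj ((i + n) %/ m + k)%N).
  by rewrite shiftE; apply: SD.
- (* Modulo [m] the class of [i] is that of [(i + n) + (m - 1) * n]. *)
  case: (noSi (n + l)%N).
  have -> : (i + (n + l) * m =
      ((i + n) %% m + l * m) + ((i + n) %/ m * m + m.-1 * n))%N.
    by case: (m) m_gt0 Ein => // p _ Ein /=; nia.
  by apply: (SD _ _ Sl); apply: SD; apply: subsemigroup_muln.
- exact: dvdn_mull.
Qed.

Lemma apery_weight_dvd_exp n : apery_weight (n %% m) %| 2 ^ (n %/ m) -> S n.
Proof.
have [_ SD] := hS.
case: (apery_weightP (n %% m)) => [[k [Sk _] ->] | [_ ->]]; last first.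
  (* 3 is a prime that does not divide 2. *)
  by rewrite Euclid_dvdX.
rewrite dvdn_Pexp2l // => k_le.
(* [n] exceeds the Apery element of its class by a multiple of [m], which lies in [S]. *)
have -> : n = ((n %% m + k * m) + (n %/ m - k) * m)%N.
  by rewrite -addnA -mulnDl subnKC // addnC -divn_eq.
by apply: SD => //; apply: subsemigroup_muln.
Qed.

End AperyWeight.

Lemma exponent_semigroup_apery {S : set nat} {m : nat} :
    additive_subsemigroup S -> S m -> (0 < m)%N ->
  S = exponent_semigroup (weighted_cycle m (apery_weight S m)).
Proof.
move=> hS Sm m_gt0; apply/seteqP; split=> n.
  move=> Sn; apply/exponent_semigroup_weighted_cycle => // [i|i _].
    exact: apery_weight_gt0.
  exact: apery_weight_dvd.
move/exponent_semigroup_weighted_cycle => /(_ (apery_weight_gt0 S m) m_gt0).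
move=> /(_ 0%N m_gt0); rewrite add0n apery_weight0 // muln1.
exact: apery_weight_dvd_exp.
Qed.

Theorem corollary3p6 (S : set nat) (hS : additive_subsemigroup S)
    (hS0 : S <> [set 0%N]) (m : nat) (hm : is_minimum (S `\ 0%N) m) :
  exists2 d : nat, is_matricial_dimension S d & (d <= m)%N.
Proof.
have [[Sm /eqP m_neq0] _] := hm.
have m_gt0 : (0 < m)%N by rewrite lt0n.
apply: min_nat_exists; split=> //.
by exists (weighted_cycle m (apery_weight S m)); apply: exponent_semigroup_apery.
Qed.
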